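(* Let $\mathbf g=(g_1,\dots,g_s)\subset\mathbb R[\mathbf X]$, $Q=\mathcal Q(\mathbf g)$ and $J=\sqrt[\mathbb R]{\operatorname{supp}Q}$. Define $\widetilde Q=\bigcup_{d\in\mathbb N}\overline{\mathcal Q_d(\mathbf g)}$, where $\overline{\mathcal Q_d(\mathbf g)}$ is the closure of $\mathcal Q_d(\mathbf g)$ in the finite-dimensional space $\mathbb R[\mathbf X]_d$. Then $\widetilde Q=Q+J$ and $\operatorname{supp}\widetilde Q=J$. In particular $\widetilde Q$ is a finitely generated quadratic module and it does not depend on the choice of the generators $\mathbf g$ of $Q$.
   Context: $\mathbb R[\mathbf X]=\mathbb R[X_1,\dots,X_n]$; $\mathbb R[\mathbf X]_t$ is the space of polynomials of degree $\le t$, with its Euclidean topology. $\Sigma^2$ denotes the cone of sums of squares of polynomials and $\Sigma^2_t=\Sigma^2\cap\mathbb R[\mathbf X]_t$. For a finite family $G\subset\mathbb R[\mathbf X]$, the truncated quadratic module is $\mathcal Q_t(G)=\{s_0+\sum_{g\in G}s_g\,g : s_0\in\Sigma^2_t,\ s_g\in\Sigma^2,\ \deg s_g\le t-\deg g\}$ (with $s_g=0$ if $\deg g>t$), and $\mathcal Q(G)=\bigcup_t\mathcal Q_t(G)=\Sigma^2+\sum_{g\in G}\Sigma^2 g$ is the quadratic module generated by $G$. For a quadratic module $Q$, $\operatorname{supp}Q=Q\cap(-Q)$ (an ideal). For an ideal $I$, its real radical is $\sqrt[\mathbb R]{I}=\{f: \exists m\in\mathbb N,\ s\in\Sigma^2,\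 f^{2m}+s\in I\}$. *)

(* Defs.v *)
From HB Require Import structures.
From mathcomp Require Import all_boot all_order all_algebra.
From mathcomp Require Import mpoly.
From mathcomp Require Import reals.
Set Implicit Arguments. Unset Strict Implicit. Unset Printing Implicit Defensive.
Import Order.TTheory GRing.Theory Num.Theory.
Local Open Scope ring_scope.

Section Defs.
Variables (R : realType) (n : nat).
Local Notation P := {mpoly R[n]}.

Definition sos (p : P) : Prop := exists s : seq P, p = \sum_(q <- s) q ^+ 2.

(* deg p <= t  (msize p = 1 + deg p, msize 0 = 0) *)
Definition deg_le (p : P) (t : nat) : Prop := (msize p <= t.+1)%N.

(* truncated quadratic module Q_t(g):
   s0 + sum_i s_i g_i, s0 SOS of degree <= t, s_i SOS with deg s_i <= t - deg g_i
   (s_i = 0 when deg g_i > t). *)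
Definition QMt (s : nat) (g : 'I_s -> P) (t : nat) (p : P) : Prop :=
  exists (s0 : P) (sg : 'I_s -> P),
    [/\ sos s0, deg_le s0 t,
        (forall i, sos (sg i) /\
           (sg i = 0 \/ (msize (sg i) + msize (g i) <= t.+2)%N)) &
        p = s0 + \sum_(i < s) sg i * g i].

Definition QM (s : nat) (g : 'I_s -> P) (p : P) : Prop := exists t, QMt g t p.

Definition supp (Q : P -> Prop) (p : P) : Prop := Q p /\ Q (- p).

Definition real_radical (I : P -> Prop) (f : P) : Prop :=
  exists (m : nat) (s : P), sos s /\ I (f ^+ (2 * m) + s).

(* closure of Q_d(g) in R[X]_d (Euclidean topology = coefficientwise
   sup-norm topology on the finite-dimensional space R[X]_d) *)
Definition closure_QMt (s : nat) (g : 'I_s -> P) (d : nat) (p : P) : Prop :=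
  deg_le p d /\
  forall eps : R, 0 < eps ->
    exists q, QMt g d q /\ forall m, `|mcoeff m p - mcoeff m q| < eps.

Definition Qtilde (s : nat) (g : 'I_s -> P) (p : P) : Prop :=
  exists d : nat, closure_QMt g d p.

Definition setadd (A B : P -> Prop) (p : P) : Prop :=
  exists a b, A a /\ B b /\ p = a + b.

End Defs.

(* Main.v *)
Require Import Defs.
From HB Require Import structures.
From mathcomp Require Import all_boot all_order all_algebra.
From mathcomp Require Import mpoly.
From mathcomp Require Import reals.
From mathcomp Require Import boolp.
From mathcomp Require Import zify ring lra.

Set Implicit Arguments. Unset Strict Implicit. Unset Printing Implicit Defensive.
Import Order.TTheory GRing.Theory Num.Theory.
Local Open Scope ring_scope.

(** Write [Q = QM g] and [J] for the real radical of its support, which here is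
    the plain radical.  The identity [h + c = (h + 2c)^2 / 4c - h^2 / 4c] shows
    that [- h^2] in [Qtilde] implies [h] in [Qtilde], whence [J] is contained in
    [Qtilde].  Conversely, if [q + r] is in [J] with [q, r] in [Q], then [q] is
    in [J]; hence the quadratic map sending the coefficients of the squares to
    an element of the truncated module, taken modulo [J] and in coordinates
    modulo the polynomials [q] with [q g_i] in [J], has no nontrivial zero.
    Its image is therefore closed, so that limits of elements of the truncated
    module stay in [Q + J].  Finite generation of [Qtilde] is then Hilbert's
    basis theorem applied to [J]. *)

(** * Quadratic modules and the real radical of the support *)

Section QuadraticModules.
Variables (R : realType) (n : nat).
Local Notation P := {mpoly R[n]}.
Implicit Types (a b p q f h : P) (Q I : P -> Prop).

Lemma scale_mpolyC (c : R) p : c *: p = c%:MP * p.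
Proof. by rewrite mul_mpolyC. Qed.

Definition quadratic_module Q :=
  [/\ Q 1, forall a b, Q a -> Q b -> Q (a + b)
    & forall a b, Q b -> Q (a ^+ 2 * b)].

Definition is_ideal I :=
  [/\ I 0, forall a b, I a -> I b -> I (a + b)
    & forall a b, I b -> I (a * b)].

Lemma sos0 : sos (0 : P).
Proof. by exists [::]; rewrite big_nil. Qed.

Lemma sos_sq a : sos (a ^+ 2).
Proof. by exists [:: a]; rewrite big_seq1. Qed.

Lemma sosD a b : sos a -> sos b -> sos (a + b).
Proof. by move=> [s ->] [t ->]; exists (s ++ t); rewrite big_cat. Qed.

Lemma sos_sqM a b : sos b -> sos (a ^+ 2 * b).
Proof.
move=> [s ->]; exists [seq a * x | x <- s].
by rewrite big_map mulr_sumr; apply: eq_bigr => x _; rewrite exprMn.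
Qed.

Lemma sos_sum (I : Type) (r : seq I) (F : I -> P) :
  (forall i, sos (F i)) -> sos (\sum_(i <- r) F i).
Proof. by move=> Fs; apply: big_ind => //; [exact: sos0 | exact: sosD]. Qed.

Section Ideal.
Variables (I : P -> Prop) (idI : is_ideal I).

Lemma is_ideal0 : I 0. Proof. by case: idI. Qed.
Lemma is_idealD a b : I a -> I b -> I (a + b). Proof. by case: idI => _ + _; apply. Qed.
Lemma is_idealMr a b : I b -> I (a * b). Proof. by case: idI => _ _; apply. Qed.
Lemma is_idealMl a b : I a -> I (a * b). Proof. by rewrite mulrC; exact: is_idealMr. Qed.
Lemma is_idealN a : I a -> I (- a). Proof. by move=> Ia; rewrite -mulN1r; apply: is_idealMr. Qed.
Lemma is_idealB a b : I a -> I b -> I (a - b).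
Proof. by move=> Ia Ib; apply: is_idealD => //; apply: is_idealN. Qed.
Lemma is_idealZ (c : R) a : I a -> I (c *: a).
Proof. by rewrite scale_mpolyC; exact: is_idealMr. Qed.
Lemma is_ideal_sum (T : Type) (r : seq T) (F : T -> P) :
  (forall i, I (F i)) -> I (\sum_(i <- r) F i).
Proof. by move=> IF; apply: big_ind => //; [exact: is_ideal0 | exact: is_idealD]. Qed.
Lemma is_ideal_exp_le f k l : (k <= l)%N -> I (f ^+ k) -> I (f ^+ l).
Proof. by move=> kl Ik; rewrite -(subnK kl) exprD; apply: is_idealMr. Qed.

End Ideal.

Section Module.
Variables (Q : P -> Prop) (qmQ : quadratic_module Q).

Lemma qm1 : Q 1. Proof. by case: qmQ. Qed.
Lemma qmD a b : Q a -> Q b -> Q (a + b). Proof. by case: qmQ => _ + _; apply. Qed.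
Lemma qm_sqM a b : Q b -> Q (a ^+ 2 * b). Proof. by case: qmQ => _ _; apply. Qed.
Lemma qm_sq a : Q (a ^+ 2). Proof. by rewrite -[_ ^+ 2]mulr1; apply/qm_sqM/qm1. Qed.
Lemma qm0 : Q 0. Proof. by have := qm_sq 0; rewrite expr0n. Qed.
Lemma qm_sum (T : Type) (r : seq T) (F : T -> P) :
  (forall i, Q (F i)) -> Q (\sum_(i <- r) F i).
Proof. by move=> QF; apply: big_ind => //; [exact: qm0 | exact: qmD]. Qed.
Lemma qm_sosM a b : sos a -> Q b -> Q (a * b).
Proof. by move=> [s ->] Qb; rewrite mulr_suml; apply: qm_sum => x; exact: qm_sqM. Qed.
Lemma qm_sos a : sos a -> Q a.
Proof. by move=> sa; rewrite -[a]mulr1; apply: qm_sosM => //; exact: qm1. Qed.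
Lemma qmZ (c : R) a : 0 <= c -> Q a -> Q (c *: a).
Proof.
move=> c0 Qa; rewrite -(sqr_sqrtr c0) scale_mpolyC rmorphXn; exact: qm_sqM.
Qed.

(** Reduces multiplication by an arbitrary polynomial to multiplication by two squares, which makes
    the support of a quadratic module an ideal. *)
Lemma difference_of_squares a : a = (2^-1 *: (a + 1)) ^+ 2 - (2^-1 *: (a - 1)) ^+ 2.
Proof.
have e : (2^-1 : R)%:MP_[n] * 2%:R = 1.
  by rewrite -(rmorph_nat (@mpolyC n R)) -rmorphM /= mulVf ?pnatr_eq0// mpolyC1.
rewrite !scale_mpolyC; transitivity (((2^-1 : R)%:MP_[n] * 2%:R) ^+ 2 * a).
  by rewrite e expr1n mul1r.
by ring.
Qed.

Lemma ideal_supp : is_ideal (supp Q).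
Proof.
split; first by split; rewrite ?oppr0; exact: qm0.
  by move=> a b [Qa Qa'] [Qb Qb']; split; rewrite ?opprD; apply: qmD.
move=> a b [Qb Qb']; rewrite [a]difference_of_squares mulrBl; split.
  by rewrite -mulrN; apply: qmD; apply: qm_sqM.
by rewrite opprB addrC -mulrN; apply: qmD; apply: qm_sqM.
Qed.

(* If [f ^+ (2 m) + s] lies in the support, then so does [f ^+ (2 m)]:
   for the support of a quadratic module the real radical is the radical. *)
Lemma real_radicalP f :
  real_radical (supp Q) f <-> exists k, supp Q (f ^+ (2 ^ k)).
Proof.
split=> [[m [s [ss [Q1 Q2]]]]|[k Qk]].
  (* Since [2 m < 2 ^ (2 m)], the exponent may be raised to a power of two. *)
  exists (2 * m)%N; apply: (is_ideal_exp_le ideal_supp (k := (2 * m)%N)).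
    by apply: ltnW; exact: ltn_expl.
  split; first by rewrite mulnC exprM; exact: qm_sq.
  have -> : - f ^+ (2 * m) = s + - (f ^+ (2 * m) + s) by ring.
  by apply: qmD => //; exact: qm_sos.
exists (2 ^ k)%N, 0; split; first exact: sos0.
by rewrite addr0 mul2n -addnn exprD; apply: (is_idealMr ideal_supp).
Qed.

Local Notation J := (real_radical (supp Q)).

Lemma real_radical_exp f k : J (f ^+ k) -> J f.
Proof.
move=> /real_radicalP[l Ql]; apply/real_radicalP; exists (k * 2 ^ l)%N.
rewrite -exprM in Ql; apply: is_ideal_exp_le Ql; first exact: ideal_supp.
by apply: ltnW; exact: ltn_expl.
Qed.

Lemma supp_real_radical f : supp Q f -> J f.
Proof. by move=> Qf; apply/real_radicalP; exists 0%N; rewrite expr1. Qed.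

Lemma ideal_real_radical : is_ideal J.
Proof.
split.
- apply: supp_real_radical; exact: (is_ideal0 ideal_supp).
- move=> a b /real_radicalP[k Qa] /real_radicalP[l Qb].
  apply: (@real_radical_exp _ (2 ^ k + 2 ^ l)); apply: supp_real_radical.
  (* In each term of the binomial expansion either [b] has exponent at least [2 ^ l] or [a] has
     exponent at least [2 ^ k]. *)
  rewrite exprDn; apply: (is_ideal_sum ideal_supp) => i.
  rewrite -mulr_natr; apply: (is_idealMl ideal_supp).
  have [li|il] := leqP (2 ^ l) i.
    by apply: (is_idealMr ideal_supp); apply: (is_ideal_exp_le ideal_supp) Qb.
  apply: (is_idealMl ideal_supp); apply: (is_ideal_exp_le ideal_supp) Qa.
  by rewrite -addnBA ?leq_addr// ltnW.
- move=> a b /real_radicalP[k Qb]; apply/real_radicalP; exists k.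
  by rewrite exprMn; apply: (is_idealMr ideal_supp).
Qed.

(** The square of [a * b] is [(a ^+ 2 * b) * b], and [J] is radical. *)
Lemma real_radical_sq_cancel a b : J (a ^+ 2 * b) -> J (a * b).
Proof.
move=> Jab; apply: (@real_radical_exp _ 2).
by rewrite exprMn expr2 [b ^+ 2]expr2 mulrA; apply: (is_idealMl ideal_real_radical).
Qed.

(* With [h = q + r], the identity
   [q^2 r + q (q - h/2)^2 = q h^2 / 4] replaces [(q, r)] by a pair of elements
   of [Q] whose sum has nilpotency order half that of [h] modulo [supp Q]. *)
Lemma real_radical_convex q r : Q q -> Q r -> J (q + r) -> J q.
Proof.
move=> Qq Qr /real_radicalP[k]; elim: k q r Qq Qr => [|k IHk] q r Qq Qr.
  rewrite expr1 => -[Q1 Q2]; apply: supp_real_radical; split=> //.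
  have -> : - q = r + - (q + r) by ring.
  exact: qmD.
set h := q + r; rewrite expnS mulnC => Qh.
have e : ((2^-1 *: h) ^+ 2 * q) = (q - 2^-1 *: h) ^+ 2 * q + q ^+ 2 * r.
  have e2 : 2^-1 *: h + 2^-1 *: h = h.
    by rewrite -scalerDl (_ : _ + _ = 1) ?scale1r//; field.
  set u := 2^-1 *: h in e2 *; have -> : r = u + u - q by rewrite e2 /h; ring.
  by ring.
have : supp Q (((q - 2^-1 *: h) ^+ 2 * q + q ^+ 2 * r) ^+ (2 ^ k)).
  (* By [e] this power is a multiple of [(h ^+ 2) ^+ (2 ^ k)], which is the power of [h] known to
     lie in the support. *)
  rewrite -e exprMn; apply: (is_idealMl ideal_supp).
  rewrite -exprM scale_mpolyC exprMn; apply: (is_idealMr ideal_supp).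
  by rewrite mulnC.
move=> /(IHk _ _ (qm_sqM _ Qq) (qm_sqM _ Qr)) J1.
have Jh : J h by apply/real_radicalP; exists k.+1; rewrite expnS mulnC.
(* As [h] lies in [J], the cube of [q] is congruent modulo [J] to [(q - h/2)^2 q], the summand that
   the induction has placed in [J]. *)
apply: (@real_radical_exp _ 3).
have -> : q ^+ 3 = (q - 2^-1 *: h) ^+ 2 * q
    + (2^-1 *: h) * (q * (2%:R * q - 2^-1 *: h)) by ring.
apply: (is_idealD ideal_real_radical) => //.
by apply: (is_idealMl ideal_real_radical); apply: (is_idealZ ideal_real_radical).
Qed.

Lemma quadratic_module_setadd : quadratic_module (setadd Q J).
Proof.
split.
- by exists 1, 0; rewrite addr0; split; [exact: qm1|split=> //; exact: (is_ideal0 ideal_real_radical)].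
- move=> _ _ [a [b [Qa [Jb ->]]]] [c [d [Qc [Jd ->]]]].
  exists (a + c), (b + d); split; first exact: qmD.
  split; first exact: (is_idealD ideal_real_radical).
  by rewrite addrACA.
- move=> c _ [a [b [Qa [Jb ->]]]]; exists (c ^+ 2 * a), (c ^+ 2 * b).
  split; first exact: qm_sqM.
  by split; [apply: (is_idealMr ideal_real_radical) | rewrite mulrDr].
Qed.

Lemma setadd_module q : Q q -> setadd Q J q.
Proof.
by move=> Qq; exists q, 0; rewrite addr0; split=> //; split=> //; exact: (is_ideal0 ideal_real_radical).
Qed.

Lemma setadd_real_radical q : J q -> setadd Q J q.
Proof. by move=> Jq; exists 0, q; rewrite add0r; split; first exact: qm0. Qed.

(** From [p = q + j] and [- p = r + l] follows [q + r = - (j + l)] in [J]; convexity then puts [q],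
    hence [p], in [J]. *)
Lemma supp_setadd p : supp (setadd Q J) p <-> J p.
Proof.
have Jid := ideal_real_radical.
split=> [[[q [j [Qq [Jj pE]]]] [r [l [Qr [Jl pE']]]]]|Jp].
  have Jqr : J (q + r).
    have -> : q + r = - (j + l).
      apply/eqP; rewrite -subr_eq0; apply/eqP.
      transitivity ((q + j) + (r + l)); first by ring.
      by rewrite -pE -pE' subrr.
    exact/(is_idealN Jid)/(is_idealD Jid).
  rewrite pE; apply: (is_idealD Jid) => //.
  exact: real_radical_convex Qq Qr Jqr.
by split; apply: setadd_real_radical => //; exact: (is_idealN Jid).
Qed.

End Module.

(** * Quadratic modules generated by finite families *)

Section Generated.
Variables (s : nat) (g : 'I_s -> P).

(* The degree constraints of [QMt] disappear for [t] large. *)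
Lemma QMP p : QM g p <-> exists (s0 : P) (sg : 'I_s -> P),
  [/\ sos s0, forall i, sos (sg i) & p = s0 + \sum_(i < s) sg i * g i].
Proof.
split=> [[t [s0 [sg [ss0 _ ssg ->]]]]|[s0 [sg [ss0 ssg ->]]]].
  by exists s0, sg; split=> // i; case: (ssg i).
exists (msize s0 + \sum_(i < s) (msize (sg i) + msize (g i)))%N, s0, sg; split=> //.
  by rewrite /deg_le -addnS leq_addr.
move=> i; split=> //; right; rewrite (bigD1 i)//=.
by rewrite addnA [X in (_ <= (X + _).+2)%N]addnC -addnA -!addnS leq_addr.
Qed.

Lemma quadratic_module_QM : quadratic_module (QM g).
Proof.
split.
- apply/QMP; exists 1, (fun=> 0); split; [|by move=> _; exact: sos0|].
    by rewrite -(expr1n P 2); exact: sos_sq.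
  by rewrite big1 ?addr0// => i _; rewrite mul0r.
- move=> a b /QMP[a0 [ag [? ? ->]]] /QMP[b0 [bg [? ? ->]]]; apply/QMP.
  exists (a0 + b0), (fun i => ag i + bg i); split; [exact: sosD|by move=> i; exact: sosD|].
  rewrite addrACA -big_split /=; congr (_ + _).
  by apply: eq_bigr => i _; rewrite mulrDl.
- move=> a b /QMP[b0 [bg [? ? ->]]]; apply/QMP.
  exists (a ^+ 2 * b0), (fun i => a ^+ 2 * bg i).
  split; [exact: sos_sqM|by move=> i; exact: sos_sqM|].
  by rewrite mulrDr mulr_sumr; congr (_ + _); apply: eq_bigr => i _; rewrite mulrA.
Qed.

Lemma QM_gen i : QM g (g i).
Proof.
apply/QMP; exists 0, (fun j => (j == i)%:R); split; first exact: sos0.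
  by move=> j; case: eqP => _ /=; [rewrite -(expr1n P 2); exact: sos_sq|exact: sos0].
rewrite add0r (bigD1 i)//= eqxx mul1r big1 ?addr0// => j /negPf ->.
by rewrite mul0r.
Qed.

Lemma QM_sub Q : quadratic_module Q -> (forall i, Q (g i)) ->
  forall p, QM g p -> Q p.
Proof.
move=> qmQ Qg p /QMP[s0 [sg [ss0 ssg ->]]].
apply: (qmD qmQ); first exact: qm_sos.
by apply: (qm_sum qmQ) => i; apply: qm_sosM.
Qed.

End Generated.
End QuadraticModules.

(** * The real radical lies in the closure *)

Section Closure.
Variables (R : realType) (n s : nat) (g : 'I_s -> {mpoly R[n]}).
Local Notation P := {mpoly R[n]}.
Implicit Types (a b p q f h : P).

Lemma deg_leW p t t' : (t <= t')%N -> deg_le p t -> deg_le p t'.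
Proof. by move=> tt' /leq_trans; apply. Qed.

Lemma deg_leD p q t : deg_le p t -> deg_le q t -> deg_le (p + q) t.
Proof.
move=> pt qt; apply: (leq_trans (msizeD_le _ _)).
by rewrite geq_max; apply/andP.
Qed.

Lemma QMtW p t t' : (t <= t')%N -> QMt g t p -> QMt g t' p.
Proof.
move=> tt' [s0 [sg [ss0 ds0 ssg ->]]]; exists s0, sg; split=> //.
  exact: deg_leW ds0.
move=> i; have [? [|le]] := ssg i; split=> //; [by left|right].
by apply: leq_trans le _; rewrite !ltnS.
Qed.

Lemma QMtD a b t : QMt g t a -> QMt g t b -> QMt g t (a + b).
Proof.
move=> [a0 [ag [sa0 da0 sag ->]]] [b0 [bg [sb0 db0 sbg ->]]].
exists (a0 + b0), (fun i => ag i + bg i); split.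
- exact: sosD.
- exact: deg_leD.
(* Zero multipliers are treated apart, because their size bound may fail when [g i] is large. *)
- move=> i; have [sa [az|da]] := sag i; have [sb [bz|db]] := sbg i;
    (split; first exact: sosD).
  + by left; rewrite az bz addr0.
  + by right; rewrite az add0r.
  + by right; rewrite bz addr0.
  + right; apply: leq_trans (leq_add (msizeD_le _ _) (leqnn _)) _.
    by rewrite addn_maxl geq_max; apply/andP.
- rewrite addrACA -big_split /=; congr (_ + _).
  by apply: eq_bigr => i _; rewrite mulrDl.
Qed.

Lemma sosZ (c : R) a : 0 <= c -> sos a -> sos (c *: a).
Proof.
by move=> c0 sa; rewrite -(sqr_sqrtr c0) scale_mpolyC rmorphXn; exact: sos_sqM.
Qed.

Lemma QMtZ (c : R) a t : 0 <= c -> QMt g t a -> QMt g t (c *: a).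
Proof.
move=> c0 [a0 [ag [sa0 da0 sag ->]]].
exists (c *: a0), (fun i => c *: ag i); split.
- exact: sosZ.
- exact: leq_trans (msizeZ_le _ _) da0.
- move=> i; have [sa [az|da]] := sag i; (split; first exact: sosZ).
    by left; rewrite az scaler0.
  by right; apply: leq_trans (leq_add (msizeZ_le _ _) (leqnn _)) _.
- rewrite scalerDr scaler_sumr; congr (_ + _).
  by apply: eq_bigr => i _; rewrite scalerAl.
Qed.

Lemma QMt_sos a t : sos a -> deg_le a t -> QMt g t a.
Proof.
move=> sa da; exists a, (fun=> 0); split=> //.
  by move=> i; split; [exact: sos0|left].
by rewrite big1 ?addr0// => i _; rewrite mul0r.
Qed.

Lemma Qtilde_QM p : QM g p -> Qtilde g p.
Proof.
move=> [t Qp]; exists (t + msize p)%N; split.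
  by rewrite /deg_le -addnS; apply: leq_trans (leq_addl _ _); exact: leqnSn.
move=> e e0; exists p; split; first exact: QMtW (leq_addr _ _) Qp.
by move=> m; rewrite subrr normr0.
Qed.

Lemma QtildeD a b : Qtilde g a -> Qtilde g b -> Qtilde g (a + b).
Proof.
move=> [d [da ca]] [d' [db cb]]; exists (d + d')%N; split.
  by apply: deg_leD; [exact: deg_leW (leq_addr _ _) da|exact: deg_leW (leq_addl _ _) db].
move=> e e0; have e20 : 0 < e / 2 by lra.
have [x [Qx ax]] := ca _ e20; have [y [Qy by_]] := cb _ e20.
exists (x + y); split.
  by apply: QMtD; [exact: QMtW (leq_addr _ _) Qx|exact: QMtW (leq_addl _ _) Qy].
move=> m; rewrite !mcoeffD opprD addrACA.
by apply: le_lt_trans (ler_normD _ _) _; have := ax m; have := by_ m; lra.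
Qed.

(* [h + c = (h + 2 c)^2 / (4 c) - h^2 / (4 c)] lies in the truncated module up
   to the closure, in a degree that does not depend on [c > 0]. *)
Lemma Qtilde_Nsq h : Qtilde g (- h ^+ 2) -> Qtilde g h.
Proof.
(* The size of [h + 2 c] is at most [(msize h).+1] for every [c], the increment covering [h = 0];
   hence one degree [D] serves all precisions. *)
move=> [d [dh ch]]; pose D := (d + ((msize h).+1 + (msize h).+1).+1)%N.
exists D; split.
  by rewrite /deg_le /D; lia.
(* The constant shift by [c] costs at most [e / 2], and an error below [c * e] on [- h ^+ 2] costs
   at most [e / 4] after division by [4 c]. *)
move=> e e0; pose c := e / 2; have c0 : 0 < c by rewrite /c; lra.
have [q [Qq hq]] := ch _ (mulr_gt0 c0 e0).
exists ((4 * c)^-1 *: ((h + (2 * c)%:MP) ^+ 2 + q)); split.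
  apply: QMtZ; first by rewrite invr_ge0; lra.
  apply: QMtD; last exact: QMtW (leq_addr _ _) Qq.
  apply: QMt_sos; first exact: sos_sq.
  have le : (msize (h + (2 * c)%:MP) <= (msize h).+1)%N.
    apply: leq_trans (msizeD_le _ _) _; rewrite geq_max leqnSn/= msizeC.
    by case: eqP.
  rewrite /deg_le expr2; apply: leq_trans (msizeM_le _ _) _; rewrite /D.
  by have := leq_add le le; lia.
move=> m; set x := _ *: _.
have -> : h@_m - x@_m = - c * (m == 0%MM)%:R + (4 * c)^-1 * ((- h ^+ 2)@_m - q@_m).
  have hE : h = (4 * c)^-1 *: ((4 * c)%:MP * h).
    by rewrite -scale_mpolyC scalerA mulVf ?scale1r//; apply/eqP; lra.
  rewrite {1}hE -!mcoeffB /x -scalerBr mcoeffZ.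
  have -> : - c * (m == 0%MM)%:R = (4 * c)^-1 * (- ((2 * c) ^+ 2)%:MP_[n])@_m.
    rewrite mcoeffN mcoeffC mulrN mulNr mulrA; congr (- (_ * _)).
    by field; apply/eqP; lra.
  rewrite -mulrDr -mcoeffD.
  congr (_ * _@_m); rewrite rmorphXn.
  have -> : (4 * c)%:MP_[n] = (2 * c)%:MP_[n] + (2 * c)%:MP_[n].
    by rewrite -mpolyCD; congr mpolyC; ring.
  by ring.
apply: le_lt_trans (ler_normD _ _) _.
have b1 : `|- c * (m == 0%MM)%:R| <= c.
  by rewrite normrM normrN (gtr0_norm c0) normr_nat; case: eqP => _ /=; lra.
have b2 : `|(4 * c)^-1 * ((- h ^+ 2)@_m - q@_m)| <= e / 4.
  rewrite normrM gtr0_norm ?invr_gt0; last lra.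
  rewrite mulrC ler_pdivrMr; last lra.
  by have := hq m; lra.
by move: b1 b2; rewrite /c; lra.
Qed.

(** With [- f] renamed [f], some [- f ^+ (2 ^ k)] lies in [Q]. Being minus a square, it lets
    [Qtilde_Nsq] halve the exponent repeatedly until [- f] remains. *)
Lemma Qtilde_real_radical f : real_radical (supp (QM g)) f -> Qtilde g f.
Proof.
have qmQ := quadratic_module_QM g.
move=> /(is_idealN (ideal_real_radical qmQ)) /(real_radicalP qmQ)[k [_ Qk]].
rewrite -[f in Qtilde g f]opprK; move: (- f) Qk => {}f /Qtilde_QM.
elim: k => [|k IHk]; first by rewrite expr1.
rewrite expnS mulnC exprM => Qk; apply/IHk/Qtilde_Nsq.
by rewrite sqrrN.
Qed.

End Closure.

(** * Compactness without sequences *)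

Section Compactness.
Variable R : realType.

(** The point [l] is the upper limit of the nested sets [S e]: the supremum of those [y] for which
    every [S e] contains some [x >= y]. *)
Lemma cluster_point (S : R -> R -> Prop) (B : R) :
  (forall e e' x, 0 < e -> e <= e' -> S e x -> S e' x) ->
  (forall e, 0 < e -> exists x, S e x) ->
  (forall e x, S e x -> `|x| <= B) ->
  exists l, forall e, 0 < e -> exists x, S e x /\ `|x - l| < e.
Proof.
move=> mono ne bd; pose E y := forall e, 0 < e -> exists x, S e x /\ y <= x.
have supE : classical_sets.has_sup E.
  split.
    exists (- B) => e e0; have [x Sx] := ne e e0; exists x; split=> //.
    by have := bd _ _ Sx; rewrite ler_norml => /andP[].
  exists B => y /(_ 1 ltr01)[x [Sx yx]]; apply: le_trans yx _.
  by have := bd _ _ Sx; rewrite ler_norml => /andP[].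
exists (sup E) => e e0.
have [y Ey ly] := sup_adherent e0 supE.
have nE : ~ E (sup E + e / 2).
  by move=> /(sup_upper_bound supE); rewrite /= => ?; lra.
have [e1 [e10 ub]] : exists e1, 0 < e1 /\ forall x, S e1 x -> x < sup E + e / 2.
  apply: contrapT => h; apply: nE => e1 e10; apply: contrapT => h1; apply: h.
  exists e1; split=> // x Sx; rewrite ltNge; apply/negP => le; apply: h1.
  by exists x.
pose d := Num.min e e1; have d0 : 0 < d by rewrite lt_min e0.
have [x [Sx yx]] := Ey d d0; exists x; split.
  by apply: mono Sx => //; rewrite ge_min lexx.
have xl : x < sup E + e / 2 by apply/ub/(mono _ _ _ d0 _ Sx); rewrite ge_min lexx orbT.
by rewrite ltr_norml; apply/andP; split; lra.
Qed.

(** One coordinate at a time: the values [z i] of those [z] whose earlier coordinates are already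
    within [e] of their limits form again a bounded nested family. *)
Lemma cluster_point_fun (T : eqType) (S : R -> (T -> R) -> Prop) (B : R) (r : seq T) :
  (forall e e' z, 0 < e -> e <= e' -> S e z -> S e' z) ->
  (forall e, 0 < e -> exists z, S e z) ->
  (forall e z, S e z -> forall t, `|z t| <= B) ->
  exists l : T -> R, forall e, 0 < e ->
    exists z, S e z /\ forall t, t \in r -> `|z t - l t| < e.
Proof.
move=> mono ne bd; elim: r => [|i r [l IH]].
  by exists (fun=> 0) => e /ne[z Sz]; exists z.
pose S1 e x := exists z, [/\ S e z, z i = x & forall t, t \in r -> `|z t - l t| < e].
have [||| li liP] := @cluster_point S1 B.
- move=> e e' x e0 ee' [z [Sz zx zl]]; exists z; split=> //; first exact: mono Sz.
  by move=> t tr; apply: lt_le_trans ee'; exact: zl.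
- by move=> e /IH[z [Sz zl]]; exists (z i), z.
- by move=> e x [z [Sz <- _]]; exact: bd Sz i.
exists (fun t => if t == i then li else l t) => e e0.
have [x [[z [Sz zx zl]] xl]] := liP e e0; exists z; split=> // t.
rewrite inE; case: eqVneq => [->|ti] /=; first by rewrite zx.
exact: zl.
Qed.

(** * Continuity in finitely many real variables *)

Section Continuity.
Variable T : finType.
Implicit Types (F G : (T -> R) -> R).

Definition cont F := forall l (e : R), 0 < e -> exists2 d, 0 < d &
  forall z, (forall t, `|z t - l t| < d) -> `|F z - F l| < e.

Lemma cont_cst c : cont (fun=> c).
Proof. by move=> l e e0; exists 1 => // z _; rewrite subrr normr0. Qed.

Lemma cont_proj t : cont (fun z => z t).
Proof. by move=> l e e0; exists e => // z; apply. Qed.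

Lemma contD F G : cont F -> cont G -> cont (fun z => F z + G z).
Proof.
move=> cF cG l e e0; have e20 : 0 < e / 2 by lra.
have [d d0 Fd] := cF l _ e20; have [d' d'0 Gd] := cG l _ e20.
exists (Num.min d d') => [|z zl]; first by rewrite lt_min d0.
have /Fd ? : forall t, `|z t - l t| < d.
  by move=> t; apply: lt_le_trans (zl t) _; rewrite ge_min lexx.
have /Gd ? : forall t, `|z t - l t| < d'.
  by move=> t; apply: lt_le_trans (zl t) _; rewrite ge_min lexx orbT.
by rewrite opprD addrACA; apply: le_lt_trans (ler_normD _ _) _; lra.
Qed.

Lemma contM F G : cont F -> cont G -> cont (fun z => F z * G z).
Proof.
move=> cF cG l e e0; pose K := `|F l| + `|G l| + 1.
have K0 : 0 < K by rewrite ltr_wpDl// addr_ge0.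
(* If both increments are below [a <= 1], the expansion of the product increment is bounded by
   [a * (1 + |F l| + |G l|) = a * K <= e / 2]. *)
pose a := Num.min 1 (e / 2 / K).
have a0 : 0 < a by rewrite lt_min ltr01/= !divr_gt0.
have [d d0 Fd] := cF l _ a0; have [d' d'0 Gd] := cG l _ a0.
exists (Num.min d d') => [|z zl]; first by rewrite lt_min d0.
have /Fd Fz : forall t, `|z t - l t| < d.
  by move=> t; apply: lt_le_trans (zl t) _; rewrite ge_min lexx.
have /Gd Gz : forall t, `|z t - l t| < d'.
  by move=> t; apply: lt_le_trans (zl t) _; rewrite ge_min lexx orbT.
have a1 : a <= 1 by rewrite ge_min lexx.
have aK : a * K <= e / 2 by rewrite -ler_pdivlMr// ge_min lexx orbT.
have -> : F z * G z - F l * G l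
  = (F z - F l) * (G z - G l) + (F z - F l) * G l + F l * (G z - G l) by ring.
apply: le_lt_trans (ler_normD _ _) _.
apply: le_lt_trans (lerD (ler_normD _ _) (lexx _)) _; rewrite !normrM.
have h1 : `|F z - F l| * `|G z - G l| <= a * 1.
  by apply: ler_pM => //; [exact: ltW|apply: le_trans a1; exact: ltW].
have h2 : `|F z - F l| * `|G l| <= a * `|G l| by rewrite ler_wpM2r// ltW.
have h3 : `|F l| * `|G z - G l| <= a * `|F l| by rewrite mulrC ler_wpM2r// ltW.
have aKE : a * K = a * `|F l| + a * `|G l| + a * 1 by rewrite /K !mulrDr.
by lra.
Qed.

Lemma cont_sum (I : Type) (r : seq I) (P : pred I) (F : I -> (T -> R) -> R) :
  (forall i, cont (F i)) -> cont (fun z => \sum_(i <- r | P i) F i z).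
Proof.
move=> cF; elim: r => [|i r IHr].
  by move=> l e e0; exists 1 => // z _; rewrite !big_nil subrr normr0.
have cD := contD (cF i) IHr; move=> l e e0.
have [Pi|nPi] := boolP (P i).
  by have [d d0 Hd] := cD l e e0; exists d => // z /Hd; rewrite !big_cons Pi.
by have [d d0 Hd] := IHr l e e0; exists d => // z /Hd; rewrite !big_cons (negPf nPi).
Qed.

(** Points of the unit cube that nearly annihilate all [F c], uniformly in [c], have a cluster
    point; continuity of each [F c] makes it a common zero. *)
Lemma compact_zero (C : Type) (F : C -> (T -> R) -> R) :
  (forall c, cont (F c)) ->
  (forall e, 0 < e -> exists z, (forall t, `|z t| <= 1) /\ forall c, `|F c z| < e) ->
  exists l, forall c, F c l = 0.
Proof.
move=> cF ex.
pose S e z := (forall t, `|z t| <= 1) /\ forall c, `|F c z| < e.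
have [|||l lP] := @cluster_point_fun T S 1 (enum T).
- move=> e e' z e0 ee' [z1 Fz]; split=> // c; exact: lt_le_trans ee'.
- by move=> e /ex[z ?]; exists z.
- by move=> e z [].
exists l => c; apply/eqP; rewrite -normr_le0; apply/ler_addgt0Pl => e e0.
rewrite addr0; have e20 : 0 < e / 2 by lra.
have [d d0 Fd] := cF c l _ e20.
pose a := Num.min d (e / 2); have a0 : 0 < a by rewrite lt_min d0.
have [z [[_ Fz] zl]] := lP a a0.
have /Fd Fzl : forall t, `|z t - l t| < d.
  by move=> t; apply: lt_le_trans (zl t (mem_enum _ _)) _; rewrite ge_min lexx.
have Fze : `|F c z| < e / 2 by apply: lt_le_trans (Fz c) _; rewrite ge_min lexx orbT.
have -> : F c l = F c z - (F c z - F c l) by ring.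
by apply: le_trans (ler_normB _ _) _; lra.
Qed.

End Continuity.
End Compactness.

(** * Continuous families of polynomials of bounded degree *)

Section PolynomialFamilies.
Variables (R : realType) (n : nat) (T : finType).
Local Notation P := {mpoly R[n]}.
Implicit Types (Psi Phi : (T -> R) -> P).

(** The uniform size bound confines the family to a fixed finite-dimensional space, where membership
    in an ideal is a finite system of linear equations. *)
Definition cont_poly Psi :=
  (forall m, cont (fun z => (Psi z)@_m)) /\ exists D, forall z, (msize (Psi z) <= D)%N.

Lemma cont_poly_cst p : cont_poly (fun=> p).
Proof. by split=> [m|]; [exact: cont_cst|exists (msize p)]. Qed.

Lemma cont_ext (F G : (T -> R) -> R) : F =1 G -> cont F -> cont G.
Proof.
by move=> FG cF l e /(cF l)[d d0 Fd]; exists d => // z /Fd; rewrite !FG.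
Qed.

Lemma cont_polyD Psi Phi : cont_poly Psi -> cont_poly Phi ->
  cont_poly (fun z => Psi z + Phi z).
Proof.
move=> [c1 [D1 b1]] [c2 [D2 b2]]; split=> [m|].
  by apply: cont_ext (contD (c1 m) (c2 m)) => z; rewrite mcoeffD.
exists (maxn D1 D2) => z; apply: leq_trans (msizeD_le _ _) _.
by rewrite geq_max !leq_max b1 b2 orbT.
Qed.

Lemma cont_polyM Psi Phi : cont_poly Psi -> cont_poly Phi ->
  cont_poly (fun z => Psi z * Phi z).
Proof.
move=> [c1 [D1 b1]] [c2 [D2 b2]]; split=> [m|].
  pose F z := \sum_(k : 'X_{1..n < (mdeg m).+1, (mdeg m).+1} | m == (k.1 + k.2)%MM)
     (Psi z)@_k.1 * (Phi z)@_k.2.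
  apply: (@cont_ext F) => [z|]; first by rewrite mcoeffM.
  by apply: cont_sum => k; apply: contM.
exists (D1 + D2).+1 => z; apply: leq_trans (msizeM_le _ _) _.
by rewrite ltnS; apply: leq_add.
Qed.

Lemma cont_polyZ (c : (T -> R) -> R) Psi : cont c -> cont_poly Psi ->
  cont_poly (fun z => c z *: Psi z).
Proof.
move=> cc [c1 [D1 b1]]; split=> [m|].
  by apply: cont_ext (contM cc (c1 m)) => z; rewrite mcoeffZ.
by exists D1 => z; apply: leq_trans (msizeZ_le _ _) _.
Qed.

Lemma cont_poly_sum (I : Type) (r : seq I) (Psi : I -> (T -> R) -> P) :
  (forall i, cont_poly (Psi i)) -> cont_poly (fun z => \sum_(i <- r) Psi i z).
Proof.
move=> cP; elim: r => [|i r IHr].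
  have [c0 [D b0]] := cont_poly_cst 0; split=> [m|].
    by apply: cont_ext (c0 m) => z; rewrite big_nil.
  by exists D => z; rewrite big_nil (b0 z).
have [cD [D bD]] := cont_polyD (cP i) IHr; split=> [m|].
  by apply: cont_ext (cD m) => z; rewrite big_cons.
by exists D => z; rewrite big_cons.
Qed.

End PolynomialFamilies.

(** * Hilbert's basis theorem *)

Section Hilbert.
Variables (R : realType) (n : nat).
Local Notation P := {mpoly R[n]}.

(** Dickson's lemma, by induction on the number of functions. A list [L0] dominating for the
    remaining functions handles all [a] with [phi a >= M], the maximum of [phi] on [L0]; below [M],
    each level set of [phi] gets its own list. *)
Lemma dickson (A : eqType) (r : seq (A -> nat)) (S : A -> Prop) :
  exists L : seq A, (forall l, l \in L -> S l) /\
    forall a, S a -> exists2 l, l \in L & all (fun phi => phi l <= phi a)%N r.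
Proof.
elim: r S => [|phi r IHr] S.
  have [[a Sa]|noS] := pselect (exists a, S a).
    by exists [:: a]; split=> [l|b _]; [rewrite inE => /eqP ->|exists a; rewrite ?inE].
  by exists [::]; split=> // a Sa; case: noS; exists a.
have [L0 [L0S L0P]] := IHr S; pose M := (\max_(l <- L0) phi l)%N.
have [L1 [L1S L1P]] : exists L : seq A, (forall l, l \in L -> S l) /\
    forall a, S a -> (phi a < M)%N ->
      exists2 l, l \in L & all (fun psi => psi l <= psi a)%N (phi :: r).
  elim: M => [|M [L [LS LP]]]; first by exists [::].
  have [L' [L'S L'P]] := IHr (fun a => S a /\ phi a = M).
  exists (L ++ L'); split=> [l|a Sa].
    by rewrite mem_cat => /orP[/LS|/L'S[]].
  rewrite ltnS leq_eqVlt => /orP[/eqP aM|aM]; last first.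
    by have [l lL al] := LP _ Sa aM; exists l; rewrite // mem_cat lL.
  have [l lL' al] := L'P a (conj Sa aM).
  by exists l; rewrite ?mem_cat ?lL' ?orbT//= al (L'S _ lL').2 aM leqnn.
exists (L0 ++ L1); split=> [l|a Sa]; first by rewrite mem_cat => /orP[/L0S|/L1S].
have [aM|Ma] := ltnP (phi a) M.
  by have [l lL al] := L1P _ Sa aM; exists l; rewrite // mem_cat lL orbT.
have [l lL al] := L0P a Sa; exists l; rewrite /= ?mem_cat ?lL// al andbT.
by apply: leq_trans Ma; exact: leq_bigmax_seq.
Qed.

(** Dickson's lemma on the exponents of leading monomials selects [F]; division by [F] lowers the
    leading monomial. Generation is phrased through all ideals containing [F], so no cofactors are
    recorded. *)
Lemma hilbert_basis (I : P -> Prop) : is_ideal I ->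
  exists F : seq P, (forall h, h \in F -> I h) /\
    forall I', is_ideal I' -> (forall h, h \in F -> I' h) -> forall f, I f -> I' f.
Proof.
move=> idI; pose r := [seq (fun p : P => mlead p i) | i <- enum 'I_n].
have [F [FI FP]] := dickson r (fun p => I p /\ p != 0).
exists F; split=> [h /FI[]//|I' idI' FI' f].
elim/mleadrect: f => f IHf If.
have [->|f0] := eqVneq f 0; first exact: is_ideal0.
have [l lF le] := FP f (conj If f0); have [Il l0] := FI _ lF.
have {}le : (mlead l <= mlead f)%MM.
  apply/mnm_lepP => i; move/allP: le => /(_ (fun p : P => mlead p i)); apply.
  by apply: map_f; rewrite mem_enum.
pose c := mleadc f / mleadc l.
have c0 : c != 0 by rewrite mulf_neq0 ?invr_eq0 ?mleadc_eq0.
pose u := (c *: 'X_[mlead f - mlead l]) * l.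
have X0 : c *: 'X_[mlead f - mlead l] != 0 :> P.
  by rewrite -mleadc_eq0 mleadZ// mleadXm mcoeffZ mcoeffX eqxx mulr1.
have lu : mlead u = mlead f by rewrite mleadM// mleadZ// mleadXm submK.
have cu : u@_(mlead f) = mleadc f.
  rewrite -{1}lu mleadM// mleadcM mleadZ// mleadXm mcoeffZ mcoeffX eqxx mulr1.
  by rewrite /c mulfVK// mleadc_eq0.
have I'u : I' u by apply: (is_idealMr idI') => //; exact: FI'.
have -> : f = (f - u) + u by rewrite subrK.
apply: (is_idealD idI') => //.
(* The zero remainder is split off because its leading monomial is [0] by convention and need not be
   strictly smaller. *)
have [->|q0] := eqVneq (f - u) 0; first exact: is_ideal0.
apply: IHf; last by apply: (is_idealB idI) => //; exact: (is_idealMr idI).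
rewrite lt_neqAle; apply/andP; split; last first.
  by apply: le_trans (mleadB_le _ _) _; rewrite lu joinxx.
by apply: contraNneq q0 => e; rewrite -mleadc_eq0 e mcoeffB cu subrr.
Qed.

End Hilbert.

(** * Linear equations and bounded sums of squares *)

Section FiniteDimension.
Variables (R : realType) (n : nat).
Local Notation P := {mpoly R[n]}.

Definition subspace (V : P -> Prop) :=
  [/\ V 0, forall a b, V a -> V b -> V (a + b) & forall (c : R) a, V a -> V (c *: a)].

Lemma subspace_sum (V : P -> Prop) (T : Type) (r : seq T) (F : T -> P) :
  subspace V -> (forall i, V (F i)) -> V (\sum_(i <- r) F i).
Proof. by move=> [V0 VD _] VF; apply: big_ind. Qed.

Lemma subspaceB (V : P -> Prop) a b : subspace V -> V a -> V b -> V (a - b).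
Proof. by move=> [_ VD VZ] Va Vb; apply: VD => //; rewrite -scaleN1r; exact: VZ. Qed.

Lemma subspace_ideal (I : P -> Prop) : is_ideal I -> subspace I.
Proof.
by move=> [I0 ID IM]; split=> // c a Ia; rewrite scale_mpolyC; exact: IM.
Qed.

(** Linear algebra in the quotient by [V], without forming it: [beta] is a maximal subfamily
    independent modulo [V], and [Lam u] holds the coordinates of [b u] in it. *)
Lemma basis_mod (V : P -> Prop) (U : finType) (b : U -> P) : subspace V ->
  exists (beta : {set U}) (Lam : U -> U -> R),
  [/\ forall u v, v \notin beta -> Lam u v = 0,
      forall x : U -> R, V (\sum_u x u *: b u - \sum_v (\sum_u x u * Lam u v) *: b v)
    & forall c : U -> R, (forall v, v \notin beta -> c v = 0) ->
        V (\sum_v c v *: b v) -> forall v, c v = 0].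
Proof.
move=> subV; have [V0 VD VZ] := subV.
pose free (beta : {set U}) := forall c : U -> R, (forall v, v \notin beta -> c v = 0) ->
  V (\sum_v c v *: b v) -> forall v, c v = 0.
have free0 : `[< free set0 >] by apply/asboolP => c c0 _ v; apply: c0; rewrite inE.
have [beta /maxsetP[/asboolP fb maxb] _] := maxset_exists (P := fun B => `[< free B >]) free0.
suff span u : exists lam : U -> R, (forall v, v \notin beta -> lam v = 0) /\
    V (b u - \sum_v lam v *: b v).
  have [Lam LamP] := fin_all_exists span.
  exists beta, Lam; split=> [u|x|//]; first exact: (LamP u).1.
  have -> : \sum_v (\sum_u x u * Lam u v) *: b v = \sum_u x u *: (\sum_v Lam u v *: b v).
    under eq_bigr do rewrite scaler_suml.
    rewrite exchange_big; apply: eq_bigr => u _.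
    by rewrite scaler_sumr; apply: eq_bigr => v _; rewrite scalerA.
  rewrite -sumrB; apply: subspace_sum => // u; rewrite -scalerBr.
  exact/VZ/(LamP u).2.
have [ub|unb] := boolP (u \in beta).
  exists (fun v => (v == u)%:R); split=> [v|].
    by case: eqVneq => // ->; rewrite ub.
  rewrite (bigD1 u)//= eqxx scale1r big1 ?addr0 ?subrr//.
  by move=> v /negPf ->; rewrite scale0r.
have nfree : ~ free (u |: beta).
  move=> /asboolP f; have := maxb _ f (subsetUr _ _).
  by move=> /setP/(_ u); rewrite in_setU1 eqxx (negPf unb).
have [c [c0 Vc [w cw]]] : exists c : U -> R, [/\ forall v, v \notin u |: beta -> c v = 0,
    V (\sum_v c v *: b v) & exists w, c w != 0].
  apply: contrapT => h; apply: nfree => c c0 Vc v; apply/eqP/negPn/negP => cv.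
  by apply: h; exists c; split=> //; exists v.
have cu : c u != 0.
  apply: contra_neq cw => cu; apply: (fb c) => // v vb.
  have [->//|vu] := eqVneq v u; apply: c0.
  by rewrite in_setU1 negb_or vu.
(* The dependence relation is solved for [b u], which is possible because [c u] is nonzero. *)
exists (fun v => if v == u then 0 else - c v / c u); split=> [v vb|].
  have [//|vu] := eqVneq v u; rewrite c0 ?oppr0 ?mul0r//.
  by rewrite in_setU1 negb_or vu.
have := VZ (c u)^-1 _ Vc; congr V; rewrite (bigD1 u)//= scalerDr scalerA mulVf// scale1r.
congr (_ + _); rewrite [in RHS](bigD1 u)//= eqxx scale0r add0r scaler_sumr -sumrN.
apply: eq_bigr => v /negPf ->.
by rewrite scalerA -scaleNr mulNr opprK mulrC.
Qed.

Lemma monomial_sum (D : nat) (f : P) : (msize f <= D)%N ->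
  f = \sum_(u : 'X_{1..n < D}) f@_u *: 'X_[u].
Proof. exact: mpolywE. Qed.

(** The equations are the coordinates modulo [V] in a maximal independent set of monomials. They
    make membership in [V] a closed condition in bounded degree. *)
Lemma subspace_equations (V : P -> Prop) (D : nat) : subspace V ->
  exists Lam : 'X_{1..n < D} -> 'X_{1..n < D} -> R, forall f, (msize f <= D)%N ->
    (V f <-> forall v, \sum_(u : 'X_{1..n < D}) f@_u * Lam u v = 0).
Proof.
move=> subV; have [V0 VD VZ] := subV.
have [beta [Lam [Lam0 LamV free]]] :=
  basis_mod (fun u : 'X_{1..n < D} => 'X_[u]) subV.
exists Lam => f fD.
have := LamV (fun u => f@_u); rewrite -monomial_sum// => Vf.
split=> [Vf' v|f0].
  apply: (free (fun v => \sum_(u : 'X_{1..n < D}) f@_u * Lam u v)) => [w wb|].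
    by rewrite big1// => u _; rewrite Lam0 ?mulr0.
  by rewrite -[X in V X](subKr f); apply: subspaceB.
by move: Vf; rewrite big1 ?subr0// => v _; rewrite f0 scale0r.
Qed.

(* Cholesky elimination of one column [a] at a time: [M] vectors of length
   [#|U|] are replaced by [#|U|] vectors with the same Gram matrix. *)
Lemma gram_reduction (U : finType) (M : nat) (w : 'I_M -> U -> R) :
  exists x : U -> U -> R, forall u v,
    \sum_j w j u * w j v = \sum_k x k u * x k v.
Proof.
suff red (r : seq U) : uniq r -> forall w : 'I_M -> U -> R,
    (forall j u, u \notin r -> w j u = 0) -> exists x : U -> U -> R,
    forall u v, \sum_j w j u * w j v = \sum_(k <- r) x k u * x k v.
  have [|x xP] := red _ (enum_uniq U) w; first by move=> j u; rewrite mem_enum.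
  by exists x => u v; rewrite xP big_enum.
elim: r {w} => [_ w w0|a r IHr /= /andP[ar ur] w w0].
  by exists (fun _ _ => 0) => u v; rewrite big_nil big1// => j _; rewrite w0 ?mul0r.
(* [A] is the squared norm of column [a], [L u] its inner product with column [u], and [w'] projects
   the columns onto its orthogonal complement. If [A = 0], column [a] vanishes and division by zero
   returns [0], as wanted. *)
pose A := \sum_j w j a ^+ 2.
have A0 : 0 <= A by apply: sumr_ge0 => j _; exact: sqr_ge0.
pose L u := \sum_j w j a * w j u.
pose w' j u := w j u - w j a / A * L u.
have wa0 : A = 0 -> forall j, w j a = 0.
  move=> AE j; have /eqP := AE; rewrite psumr_eq0; last by move=> ? _; exact: sqr_ge0.
  by move=> /allP/(_ j (mem_index_enum _)); rewrite sqrf_eq0 => /eqP.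
have [|x xP] := IHr ur w'.
  move=> j u ur'; have [->|ua] := eqVneq u a.
    have [AE|AN] := eqVneq A 0; first by rewrite /w' wa0// mul0r mul0r subrr.
    have LA : L a = A by apply: eq_bigr => k _; rewrite expr2.
    by rewrite /w' LA mulfVK// subrr.
  have wu k : w k u = 0 by rewrite w0// inE negb_or ua.
  by rewrite /w' wu /L big1 ?mulr0 ?subr0// => k _; rewrite wu mulr0.
exists (fun k u => if k == a then L u / Num.sqrt A else x k u) => u v.
rewrite big_cons eqxx.
have -> : \sum_(k <- r) (if k == a then L u / Num.sqrt A else x k u)
    * (if k == a then L v / Num.sqrt A else x k v) = \sum_(k <- r) x k u * x k v.
  by apply: eq_big_seq => k kr; case: eqVneq => // ka; rewrite -ka kr in ar.
rewrite -xP mulrACA -invfM -expr2 sqr_sqrtr//.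
have -> : \sum_j w' j u * w' j v =
    \sum_j w j u * w j v - L u * L v / A - L u * L v / A + A * (L u / A * (L v / A)).
  have -> : A * (L u / A * (L v / A)) = \sum_j w j a ^+ 2 * (L u / A * (L v / A)).
    by rewrite -mulr_suml.
  have -> : L u * L v / A = \sum_j w j a * w j u * (L v / A).
    by rewrite -mulr_suml mulrA.
  have e : \sum_j w j a * w j u * (L v / A) = \sum_j w j a * w j v * (L u / A).
    by rewrite -!mulr_suml -!/(L _) mulrCA mulrA.
  rewrite {2}e -!sumrB -big_split /=; apply: eq_bigr => j _.
  by rewrite /w'; ring.
have [AE|AN] := eqVneq A 0; first by rewrite AE invr0 !mulr0 !subr0 addr0 add0r.
by field.
Qed.

Lemma sqr_sumZ (U : finType) (c : U -> R) (b : U -> P) :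
  (\sum_u c u *: b u) ^+ 2 = \sum_u \sum_v (c u * c v) *: (b u * b v).
Proof.
rewrite expr2 mulr_suml; apply: eq_bigr => u _; rewrite mulr_sumr.
by apply: eq_bigr => v _; rewrite -scalerAl -scalerAr scalerA.
Qed.

(** Leading terms of squares cannot cancel: at twice the largest leading monomial [m], the
    coefficient of the sum is the sum of the squares of the coefficients at [m]. *)
Lemma msize_sum_sq (s : seq P) q : q \in s ->
  (msize q <= msize (\sum_(p <- s) p ^+ 2)%R)%N.
Proof.
move=> qs; have [->|q0] := eqVneq q 0; first by rewrite msize0.
have [q1 q1s q1P] : exists2 q1, q1 \in s & forall p, p \in s -> (mlead p <= mlead q1)%O.
  have: s != [::] by case: s qs.
  elim: {qs} s => // p [|p' s] IHs _.
    by exists p; rewrite ?inE// => p1; rewrite inE => /eqP ->.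
  have [q1 q1s q1P] := IHs isT.
  have [le|lt] := leP (mlead p) (mlead q1).
    exists q1; first by rewrite in_cons q1s orbT.
    by move=> p1; rewrite in_cons => /orP[/eqP->//|/q1P].
  exists p; first by rewrite in_cons eqxx.
  move=> p1; rewrite in_cons => /orP[/eqP->//|/q1P].
  by move=> /le_trans; apply; exact: ltW.
set m := mlead q1 in q1P.
(* The maximum may be attained at [q1 = 0], whose leading monomial is [0]; then [m = 0] is also the
   leading monomial of the nonzero [q]. *)
have [q2 q2s q2m] : exists2 q2, q2 \in s & q2@_m != 0.
  have [q10|] := eqVneq q1 0; last by rewrite -mleadc_eq0; exists q1.
  exists q => //; suff -> : m = mlead q by rewrite mleadc_eq0.
  by apply/le_anti; rewrite q1P// /m q10 mlead0 le0x.
have cE : (\sum_(p <- s) p ^+ 2)@_(m + m) = \sum_(p <- s) (p@_m) ^+ 2.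
  rewrite raddf_sum /=; apply: eq_big_seq => p ps.
  by rewrite expr2 mleadcMW ?q1P// -expr2.
have : (m + m)%MM \in msupp (\sum_(p <- s) p ^+ 2).
  rewrite mcoeff_msupp cE psumr_neq0; last by move=> ? _; exact: sqr_ge0.
  by apply/hasP; exists q2 => //=; rewrite lt_neqAle eq_sym sqrf_eq0 q2m sqr_ge0.
move=> /msize_mdeg_lt; apply: leq_trans; rewrite -mlead_deg// ltnS mdegD.
by apply: leq_trans (leq_addr _ _); apply: lemc_mdeg; exact: q1P.
Qed.

(** Both the degrees and the number of the squares become bounded in terms of [D], so that sums of
    squares are parametrised by a fixed finite set of coefficients. *)
Lemma sos_bounded (D : nat) (a : P) : sos a -> (msize a <= D)%N ->
  exists x : 'X_{1..n < D} -> 'X_{1..n < D} -> R,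
    a = \sum_k (\sum_u x k u *: 'X_[u]) ^+ 2.
Proof.
move=> [s aE] aD.
have [x xP] := gram_reduction (fun (j : 'I_(size s)) (u : 'X_{1..n < D}) => (s`_j)@_u).
exists x; rewrite aE (big_nth 0) big_mkord.
under [RHS]eq_bigr do rewrite sqr_sumZ.
have -> : \sum_(j < size s) s`_j ^+ 2 = \sum_(j < size s)
    \sum_(u : 'X_{1..n < D}) \sum_(v : 'X_{1..n < D})
      (s`_j@_u * s`_j@_v) *: ('X_[u] * 'X_[v]).
  apply: eq_bigr => j _; rewrite -sqr_sumZ -monomial_sum//.
  by apply: leq_trans aD; rewrite aE; apply/msize_sum_sq/mem_nth.
rewrite exchange_big [RHS]exchange_big; apply: eq_bigr => u _.
rewrite exchange_big [RHS]exchange_big; apply: eq_bigr => v _.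
by rewrite -!scaler_suml xP.
Qed.

End FiniteDimension.

(** * The closure of the truncated modules *)

Section Closedness.
Variables (R : realType) (n s : nat) (g : 'I_s -> {mpoly R[n]}).
Local Notation P := {mpoly R[n]}.
Local Notation Q := (QM g).
Local Notation J := (real_radical (supp Q)).
Implicit Types (p q : P).

Let qmQ : quadratic_module Q := quadratic_module_QM g.
Let idJ : is_ideal J := ideal_real_radical qmQ.

(* The index [ord0] stands for the implicit generator [1]. *)
Definition gen1 (i : 'I_s.+1) : P := oapp g 1 (unlift ord0 i).

Lemma QM_gen1 i : Q (gen1 i).
Proof. by rewrite /gen1; case: unlift => [j|] /=; [exact: QM_gen|exact: qm1]. Qed.

(** The bound [d.+2] on monomial degrees accommodates multipliers of a zero generator, whose size
    may reach [d.+2]. *)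
Lemma QMt_squares d q : QMt g d q ->
  exists x : 'I_s.+1 -> 'X_{1..n < d.+2} -> 'X_{1..n < d.+2} -> R,
    q = \sum_i (\sum_k (\sum_u x i k u *: 'X_[u]) ^+ 2) * gen1 i.
Proof.
move=> [s0 [sg [ss0 ds0 ssg ->]]].
pose sig i := oapp sg s0 (unlift ord0 i).
have sigE i : exists x : 'X_{1..n < d.+2} -> 'X_{1..n < d.+2} -> R,
    sig i = \sum_k (\sum_u x k u *: 'X_[u]) ^+ 2.
  apply: sos_bounded; rewrite /sig; case: unlift => [j|] //=.
  - by case: (ssg j).
  - case: (ssg j) => _ [->|]; first by rewrite msize0.
    by apply: leq_trans; exact: leq_addr.
  - exact: leqW.
have [x xP] := fin_all_exists sigE.
exists x; transitivity (\sum_i sig i * gen1 i); last by apply: eq_bigr => i _; rewrite xP.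
rewrite big_ord_recl /sig /gen1 unlift_none /= mulr1; congr (_ + _).
by apply: eq_bigr => i _; rewrite liftK.
Qed.

Lemma QMt_msize d q : QMt g d q -> (msize q <= d.+3)%N.
Proof.
move=> [s0 [sg [_ ds0 ssg ->]]]; apply: leq_trans (msizeD_le _ _) _.
rewrite geq_max; apply/andP; split; first by apply: leq_trans ds0 _; lia.
apply: leq_trans (msize_sum _ _ _) _; apply/bigmax_leqP_seq => i _ _.
case: (ssg i) => _ [->|le]; first by rewrite mul0r msize0.
by apply: leq_trans (msizeM_le _ _) _; rewrite ltnS.
Qed.

(** Convexity applied to one term against the sum of the others. *)
Lemma real_radical_sum_terms (I : finType) (F : I -> P) :
  (forall i, Q (F i)) -> J (\sum_i F i) -> forall i, J (F i).
Proof.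
move=> QF JF i; move: JF; rewrite (bigD1 i)//=; apply: real_radical_convex => //.
by rewrite big_mkcond; apply: (qm_sum qmQ) => j; case: ifP => // _; exact: qm0.
Qed.

(* Homogenisation: an approximation [y] of [p] is replaced by the unit vector
   proportional to [(1, y)], so that the cluster points form a compact set.
   The coordinates are taken in a basis modulo [{q | q * gen1 i \in J}], which
   makes the limit form anisotropic modulo [J] and the first coordinate of a
   cluster point nonzero. *)
Lemma Qtilde_sub_setadd p : Qtilde g p -> setadd Q J p.
Proof.
move=> [d [dp cp]]; pose U : finType := 'X_{1..n < d.+2}.
pose X (u : U) : P := 'X_[u].
have subV i : subspace (fun q => J (q * gen1 i)).
  split=> [|a b|c a]; rewrite ?mul0r ?mulrDl -?scalerAl.
  - exact: (is_ideal0 idJ).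
  - exact: (is_idealD idJ).
  - exact: (is_idealZ idJ).
have [beta /fin_all_exists[Lam LamP]] := fin_all_exists (fun i => basis_mod X (subV i)).
(* Each generator carries [#|U|] squares with [#|U|] coefficients each; [None] is the homogenising
   variable. *)
pose T : finType := option ('I_s.+1 * U * U).
pose lin (z : T -> R) i k := \sum_u z (Some (i, k, u)) *: X u.
pose Phi z := \sum_i (\sum_k lin z i k ^+ 2) * gen1 i.
pose Psi z := Phi z - (z None) ^+ 2 *: p.
have QPhi z : Q (Phi z).
  apply: (qm_sum qmQ) => i; apply: (qm_sosM qmQ); last exact: QM_gen1.
  by apply: sos_sum => k; exact: sos_sq.
have cPsi : cont_poly Psi.
  apply: cont_polyD.
    apply: cont_poly_sum => i; apply: cont_polyM; last exact: cont_poly_cst.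
    apply: cont_poly_sum => k.
    have cl : cont_poly (fun z => lin z i k).
      apply: cont_poly_sum => u; apply: cont_polyZ; last exact: cont_poly_cst.
      exact: cont_proj.
    exact: (cont_polyM cl cl).
  have c2 : cont (fun z : T -> R => - (z None * z None)).
    have := contM (cont_cst (R := R) (T := T) (-1)) (contM (cont_proj (R := R) (T := T) None) (cont_proj None)).
    by apply: cont_ext => z; rewrite mulN1r.
  have [h1 [B h2]] := cont_polyZ c2 (cont_poly_cst T p); split=> [m|].
    by apply: cont_ext (h1 m) => z; rewrite scaleNr expr2.
  by exists B => z; rewrite expr2 -scaleNr.
have [cPsim [B0 B0P]] := cPsi; pose B := maxn B0 d.+3.
have [Eq EqP] := subspace_equations B (subspace_ideal idJ).
pose ev v (f : P) := \sum_(u : 'X_{1..n < B}) f@_u * Eq u v.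
have evB v a b : ev v (a - b) = ev v a - ev v b.
  by rewrite -sumrB; apply: eq_bigr => u _; rewrite mcoeffB mulrBl.
have evZ v c a : ev v (c *: a) = c * ev v a.
  by rewrite mulr_sumr; apply: eq_bigr => u _; rewrite mcoeffZ mulrA.
(* The common zeros of [F] are the unit vectors [z] with [Psi z] in [J] whose coefficients for
   generator [i] are supported on [beta i]. *)
pose F (c : option ('X_{1..n < B} + 'I_s.+1 * U * U)) (z : T -> R) : R :=
  match c with
  | None => \sum_t z t * z t - 1
  | Some (inl v) => ev v (Psi z)
  | Some (inr (i, k, u)) => if u \in beta i then 0 else z (Some (i, k, u))
  end.
have cF c : cont (F c).
  case: c => [[v|[[i k] u]]|]; rewrite /F.
  - rewrite /ev; apply: cont_sum => u; apply: contM; [exact: cPsim|exact: cont_cst].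
  - by case: (u \in beta i) => /=; [exact: cont_cst|exact: cont_proj].
  - apply: contD; last exact: cont_cst.
    by apply: cont_sum => t; apply: contM; exact: cont_proj.
(* [K] bounds every [ev v f] for [f] with coefficients of absolute value at most 1, whence the
   precision [e / (K + 1)]. *)
pose K := \sum_v \sum_u `|Eq u v|.
have K0 : 0 <= K by apply: sumr_ge0 => v _; apply: sumr_ge0.
have [e e0|l lP] := compact_zero cF.
  have K1 : 0 < K + 1 by rewrite ltr_wpDl.
  have [q [Qq qp]] := cp _ (divr_gt0 e0 K1).
  have [x xq] := QMt_squares Qq.
  pose x' i k v := \sum_u x i k u * Lam i u v.
  pose y (t : T) := if t is Some (i, k, v) then x' i k v else 1.
  (* Reducing a square root [a] to [b] changes the term by [(a - b) (a + b) gen1 i], and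
     [(a - b) gen1 i] is in [J]. *)
  have Jy : J (Phi y - q).
    rewrite xq -sumrB; apply: (is_ideal_sum idJ) => i; rewrite -mulrBl -sumrB mulr_suml.
    apply: (is_ideal_sum idJ) => k; rewrite -opprB mulNr; apply: (is_idealN idJ).
    rewrite subr_sqr mulrAC; apply: (is_idealMl idJ).
    by have [_ + _] := LamP i; apply.
  pose N2 := \sum_t y t * y t.
  (* The coordinate [1] at [None] keeps the norm at least 1, so scaling does not enlarge the
     errors. *)
  have N21 : 1 <= N2.
    rewrite /N2 (bigD1 None)//= mulr1 lerDl; apply: sumr_ge0 => t _.
    by rewrite -expr2 sqr_ge0.
  have N0 : 0 < Num.sqrt N2 by rewrite sqrtr_gt0; apply: lt_le_trans N21.
  have NE : Num.sqrt N2 ^+ 2 = N2 by rewrite sqr_sqrtr//; apply: le_trans N21.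
  set N := Num.sqrt N2 in N0 NE.
  pose z t := N^-1 * y t.
  have zz : \sum_t z t * z t = 1.
    under eq_bigr do rewrite mulrACA.
    by rewrite -mulr_sumr -/N2 -NE; field; rewrite gt_eqF.
  have linz i k : lin z i k = N^-1 *: lin y i k.
    by rewrite scaler_sumr; apply: eq_bigr => u _; rewrite scalerA.
  have Psiz : Psi z = N^-1 ^+ 2 *: (Phi y - p).
    rewrite scalerBr /Psi /z mulr1; congr (_ - _).
    rewrite scaler_sumr; apply: eq_bigr => i _; rewrite scalerAl; congr (_ * _).
    by rewrite scaler_sumr; apply: eq_bigr => k _; rewrite linz exprZn.
  have dqp : (msize (q - p) <= B)%N.
    apply: leq_trans (msizeD_le _ _) _; rewrite msizeN geq_max; apply/andP; split.
      by apply: leq_trans (QMt_msize Qq) _; exact: leq_maxr.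
    by apply: leq_trans dp _; apply: leq_trans (leq_maxr _ _); lia.
  exists z; split=> [t|c].
    rewrite -(@ler_pXn2r _ 2)// ?nnegrE// -normrX ger0_norm ?sqr_ge0// expr1n -zz.
    rewrite (bigD1 t)//= -expr2 lerDl; apply: sumr_ge0 => u _.
    by rewrite -expr2 sqr_ge0.
  case: c => [[v|[[i k] u]]|] /=; last by rewrite zz subrr normr0.
    (* In bounded size [ev] depends only on the class modulo [J], so [Phi y] may be traded for the
       true approximant [q]. *)
    have -> : ev v (Psi z) = N^-1 ^+ 2 * ev v (q - p).
      apply/eqP; rewrite -subr_eq0 -evZ -evB; apply/eqP.
      move: v; apply/EqP; last first.
        rewrite Psiz -scalerBr; apply: (is_idealZ idJ).
        by have -> : Phi y - p - (q - p) = Phi y - q by ring.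
      apply: leq_trans (msizeD_le _ _) _; rewrite msizeN geq_max; apply/andP; split.
        by apply: leq_trans (B0P _) _; exact: leq_maxl.
      exact: leq_trans (msizeZ_le _ _) _.
    rewrite normrM; apply: (@le_lt_trans _ _ (e / (K + 1) * K)); last first.
      by rewrite mulrAC -mulrA gtr_pMr// ltr_pdivrMr// mul1r ltrDl.
    rewrite -[leRHS]mul1r; apply: ler_pM => //.
      by rewrite ger0_norm ?sqr_ge0// exprVn NE invf_le1// (lt_le_trans ltr01).
    apply: le_trans (ler_norm_sum _ _ _) _.
    apply: (@le_trans _ _ (\sum_u e / (K + 1) * `|Eq u v|)).
      apply: ler_sum => u _; rewrite normrM ler_wpM2r//.
      by rewrite mcoeffB distrC ltW.
    rewrite -mulr_sumr ler_wpM2l//; first by rewrite divr_ge0// ltW.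
    by rewrite /K [leRHS](bigD1 v)//= lerDl; do 2![apply: sumr_ge0 => *].
  case: ifPn => ub; first by rewrite normr0.
  by rewrite /z /= /x' big1 ?mulr0 ?normr0// => w _; have [-> //] := LamP i; rewrite mulr0.
have JPsi : J (Psi l).
  apply: (EqP _ _).2 => [|v]; last exact: (lP (Some (inl v))).
  by apply: leq_trans (B0P _) _; exact: leq_maxl.
(* If [l None = 0], then [Phi l] is in [J], hence so is each of its terms and, after cancelling a
   square, each [lin l i k * gen1 i]. Independence over [beta i] forces [l = 0], against its unit
   norm. *)
have [l0|l0] := eqVneq (l None) 0.
  have := lP None; rewrite /= big1 ?sub0r; first by move=> /eqP; rewrite oppr_eq0 oner_eq0.
  move=> [[[i k] u]|] _; last by rewrite l0 mulr0.
  suff -> : l (Some (i, k, u)) = 0 by rewrite mulr0.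
  have [_ _ free] := LamP i.
  apply: (free (fun u => l (Some (i, k, u)))) => [v vb|].
    by have := lP (Some (inr (i, k, v))); rewrite /= (negPf vb).
  apply: (real_radical_sq_cancel qmQ).
  move: JPsi; rewrite /Psi l0 expr0n scale0r subr0 => /real_radical_sum_terms JPhi.
  have Qsq j : Q ((\sum_k lin l j k ^+ 2) * gen1 j).
    apply: (qm_sosM qmQ); last exact: QM_gen1.
    by apply: sos_sum => k'; exact: sos_sq.
  have := JPhi Qsq i; rewrite mulr_suml => /real_radical_sum_terms; apply=> k'.
  by apply: (qm_sqM qmQ); exact: QM_gen1.
(* Dehomogenising, [p = c Phi l - c Psi l] with [Phi l] in [Q] and [Psi l] in [J]. *)
pose c := (l None ^+ 2)^-1.
exists (c *: Phi l), (- (c *: Psi l)); split; last split.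
- by apply: (qmZ qmQ) => //; rewrite invr_ge0 sqr_ge0.
- by apply: (is_idealN idJ); apply: (is_idealZ idJ).
- rewrite -scalerBr opprB addrC subrK scalerA mulVf ?scale1r//.
  by rewrite sqrf_eq0.
Qed.

End Closedness.

(** * The union of the closures, its support and its generators *)

Lemma Qtilde_setadd (R : realType) (n s : nat) (g : 'I_s -> {mpoly R[n]}) p :
  Qtilde g p <-> setadd (QM g) (real_radical (supp (QM g))) p.
Proof.
split=> [|[a [b [Qa [Jb ->]]]]]; first exact: Qtilde_sub_setadd.
by apply: QtildeD; [exact: Qtilde_QM|exact: Qtilde_real_radical].
Qed.

Theorem mainTheorem1 (R : realType) (n s : nat) (g : 'I_s -> {mpoly R[n]}) :
  let Q := QM g in
  let J := real_radical (supp Q) in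
  (forall p, Qtilde g p <-> setadd Q J p) /\
  (forall p, supp (Qtilde g) p <-> J p) /\
  (exists (k : nat) (h : 'I_k -> {mpoly R[n]}),
      forall p, Qtilde g p <-> QM h p) /\
  (forall (k : nat) (h : 'I_k -> {mpoly R[n]}),
      (forall p, QM h p <-> Q p) -> forall p, Qtilde h p <-> Qtilde g p).
Proof.
move=> Q J; have qmQ : quadratic_module Q := quadratic_module_QM g.
have idJ : is_ideal J := ideal_real_radical qmQ.
have QE p : Qtilde g p <-> setadd Q J p := Qtilde_setadd g p.
split=> //; split; last split.
- move=> p; apply: iff_trans (supp_setadd qmQ p).
  by split=> -[h1 h2]; split; apply/QE.
- have [F [FJ JF]] := hilbert_basis idJ.
  (* Ideal generators of [J] enter with both signs, so that they lie in the support of [QM h]; this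
     support is an ideal and hence contains [J]. *)
  pose L := codom g ++ F ++ [seq - f | f <- F].
  pose h (i : 'I_(size L)) := L`_i.
  have qmh := quadratic_module_QM h.
  have hL f : f \in L -> QM h f.
    move=> fL; have := QM_gen h (Ordinal (etrans (index_mem f L) fL)).
    by rewrite /h /= nth_index.
  exists (size L), h => p; apply: iff_trans (QE p) _; split.
    move=> [a [b [Qa [Jb ->]]]]; apply: (qmD qmh).
      apply: QM_sub Qa => // i; apply: hL.
      by rewrite mem_cat codom_f.
    have [] // := JF _ (ideal_supp qmh) _ b Jb.
    move=> f fF; split; apply: hL; rewrite !mem_cat ?fF ?orbT//.
    by rewrite (map_f (fun f => - f) fF) !orbT.
  apply: QM_sub; first exact: quadratic_module_setadd.
  move=> i; have : h i \in L by apply: mem_nth.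
  rewrite !mem_cat => /orP[/codomP[j ->]|/orP[/FJ|/mapP[f /FJ Jf ->]]].
  + by apply: (setadd_module qmQ); exact: QM_gen.
  + exact: (setadd_real_radical qmQ).
  + by apply: (setadd_real_radical qmQ); exact: (is_idealN idJ).
- move=> k h hQ p; apply: iff_trans (iff_sym (QE p)).
  (* The set [Q + J] depends only on the set [Q], so extensional equality of the modules
     suffices. *)
  have -> : Q = QM h by apply/funext => q; apply/propext; split=> /hQ.
  have JE : J = real_radical (supp (QM h)).
    by rewrite /J; congr (real_radical (supp _)); apply/funext => q; apply/propext; split=> /hQ.
  by rewrite JE; exact: Qtilde_setadd.
Qed.
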